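(* Let $(\Omega,\Sigma,\nu)$ be a complete probability space, let $X$ and $Y$ be Banach spaces and let $T:X\to Y$ be a semi-embedding. If $X$ has property $(\mathcal{D}')$ and $Y$ has the $\nu$-RNP, then $X$ has the $\nu$-WRNP.
   Context: All Banach spaces are real. An operator is a continuous linear map. A semi-embedding is an injective operator $T:X\to Y$ such that $T(B_X)$ is norm closed in $Y$, where $B_X$ is the closed unit ball of $X$. $X$ has property $(\mathcal{D}')$ if every $w^*$-sequentially closed (norm-closed linear) subspace of $X^*$ is $w^*$-closed, where $w^*$ is the weak$^*$ topology. A function $f:\Omega\to X$ is Pettis integrable if $\langle x^*,f\rangle:\omega\mapsto x^*(f(\omega))$ is $\nu$-integrable for every $x^*\in X^*$ and for every $A\in\Sigma$ there is $\int_A f\,d\nu\in X$ with $x^*(\int_A f\,d\nu)=\int_A\langle x^*,f\rangle\,d\nu$ for all $x^*\in X^*$. $Y$ has the $\nu$-Radon-Nikodým property ($\nu$-RNP) if for every countably additive vector measure $I:\Sigma\to Y$ of bounded variation with $I(A)=0$ whenever $\nu(A)=0$ there is a Bochner integrable function $g:\Omega\to Y$ such that $I(A)=\int_A g\,d\nu$ for all $A\in\Sigma$. $X$ has the $\nu$-weak Radon-Nikodým property ($\nu$-WRNP) if for every countably additive vector measure $I:\Sigma\to X$ of $\sigma$-finite variation with $I(A)=0$ whenever $\nu(A)=0$ there is a Pettis integrable function $f:\Omega\to X$ such that $I(A)=\int_A f\,d\nu$ (Pettis integral) for all $A\in\Sigma$. *)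

(* Defs.v *)
From HB Require Import structures.
From mathcomp Require Import all_boot all_order all_algebra.
From mathcomp Require Import all_classical all_reals all_analysis.
Import Order.TTheory GRing.Theory Num.Theory.
Import numFieldNormedType.Exports.

Set Implicit Arguments.
Unset Strict Implicit.
Unset Printing Implicit Defensive.

Local Open Scope classical_set_scope.
Local Open Scope ring_scope.

Definition unit_ball {R : realType} (X : normedModType R) : set X :=
  [set x | `|x| <= 1].
Arguments unit_ball {R} X.

(* The dual X^* is kept as a set of functions, so that it inherits the vector
   space structure of X -> R^o and the topology of {ptws X -> R^o}. *)
Definition dual {R : realType} (X : normedModType R) : set (X -> R^o) :=
  [set f | linear f /\ continuous f].
Arguments dual {R} X.

Section BanachSpaces.
Context {R : realType}.

Definition semi_embedding (X Y : normedModType R) (T : {linear X -> Y}) :=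
  [/\ continuous T, injective T & closed (T @` unit_ball X)].

Definition dual_norm (X : normedModType R) (f : X -> R^o) : R :=
  sup [set `|f x| | x in unit_ball X].

Definition linear_subspace (X : normedModType R) (S : set (X -> R^o)) :=
  [/\ S `<=` dual X, S 0 & forall a f g, S f -> S g -> S (a *: f + g)].

Definition norm_closed (X : normedModType R) (S : set (X -> R^o)) :=
  forall f, dual X f ->
    (forall e, 0 < e -> exists2 g, S g & dual_norm (f - g) < e) -> S f.

(* The weak* topology is the topology of pointwise convergence on X,
   relativized to the dual. *)
Definition weak_star_closed (X : normedModType R) (S : set (X -> R^o)) :=
  closed (S : set (subspace (dual X : set {ptws X -> R^o}))).

Definition weak_star_seq_closed (X : normedModType R) (S : set (X -> R^o)) :=
  forall (u : nat -> X -> R^o) f,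
    (forall n, S (u n)) -> dual X f -> {ptws, u @ \oo --> f} -> S f.

Definition property_D' (X : normedModType R) :=
  forall S : set (X -> R^o), linear_subspace S -> norm_closed S ->
    weak_star_seq_closed S -> weak_star_closed S.

End BanachSpaces.

Section VectorMeasures.
Context {d : measure_display} {Omega : measurableType d} {R : realType}.
Context {X : normedModType R}.
Implicit Types (I : set Omega -> X) (A : set Omega).

(* Only the values of I on measurable sets are ever constrained. *)
Definition countably_additive I :=
  forall F : nat -> set Omega, (forall n, measurable (F n)) ->
    trivIset setT F -> series (I \o F) @ \oo --> I (\bigcup_n F n).

Definition abs_continuous (nu : set Omega -> \bar R) I :=
  forall A, measurable A -> nu A = 0%E -> I A = 0.

Definition vector_variation I A : \bar R :=
  ereal_sup [set r | exists (n : nat) (F : 'I_n -> set Omega),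
    [/\ forall i, measurable (F i), trivIset setT F,
        \bigcup_i F i = A & r = (\sum_(i < n) `|I (F i)|)%:E]].

Definition bounded_variation I := (vector_variation I setT < +oo)%E.

Definition sigma_finite_variation I :=
  exists F : nat -> set Omega,
    [/\ forall n, measurable (F n), \bigcup_n F n = setT
      & forall n, (vector_variation I (F n) < +oo)%E].

End VectorMeasures.

Section Integrals.
Context {d : measure_display} {Omega : measurableType d} {R : realType}.
Context {X : normedModType R} (nu : probability Omega R).
Implicit Types (f g : Omega -> X) (s : nat -> Omega -> X) (A : set Omega).

Definition simple_function g :=
  finite_set (range g) /\ forall x, measurable (g @^-1` [set x]).

Definition simple_integral A g : X :=
  \sum_(x \in range g) fine (nu (A `&` g @^-1` [set x])) *: x.

Definition strongly_measurable g :=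
  exists2 s, forall n, simple_function (s n)
    & {ae nu, forall w, s ^~ w @ \oo --> g w}.

Definition simple_L1_cvg s g :=
  (forall n, simple_function (s n)) /\
  (fun n => \int[nu]_w `|s n w - g w|%:E)%E @ \oo --> 0%E.

Definition bochner_integrable g :=
  strongly_measurable g /\ exists s, simple_L1_cvg s g.

(* For a Bochner integrable g the limit v below exists and does not depend on
   the approximating sequence s. *)
Definition is_bochner_integral A g (v : X) :=
  exists2 s, simple_L1_cvg s g
    & (fun n => simple_integral A (s n)) @ \oo --> v.

Definition is_pettis_integral A f (v : X) :=
  forall phi, dual X phi -> phi v = \int[nu]_(w in A) phi (f w).

Definition pettis_integrable f :=
  (forall phi, dual X phi -> nu.-integrable setT (EFin \o (phi \o f))) /\
  forall A, measurable A -> exists v, is_pettis_integral A f v.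

End Integrals.

Section RadonNikodym.
Context {d : measure_display} {Omega : measurableType d} {R : realType}.
Variable nu : probability Omega R.

Definition RNP (Y : normedModType R) :=
  forall I : set Omega -> Y, countably_additive I -> bounded_variation I ->
    abs_continuous nu I ->
  exists2 g, bochner_integrable nu g
    & forall A, measurable A -> is_bochner_integral nu A g (I A).

Definition WRNP (X : normedModType R) :=
  forall I : set Omega -> X, countably_additive I ->
    sigma_finite_variation I -> abs_continuous nu I ->
  exists2 f, pettis_integrable nu f
    & forall A, measurable A -> is_pettis_integral nu A f (I A).

End RadonNikodym.

(* Main.v *)
(* The measure [T o I] has, on each piece of finite variation, a Bochner density
   [g].  Where [g] avoids [T(m B_X)] one can cover by countably many sets on which
   [g] lies in a small ball missing [T(m B_X)]; by averaging, [|I A| >= m nu(A)]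
   for every measurable [A] inside one of them, so that the finiteness of the
   variation forces the measure of the exceptional set to be at most [V / m].
   Hence [g = T o f] almost everywhere.  The functionals [phi] for which
   [phi o f] is measurable with the right integrals on the sets where [f] is
   bounded form a weak* sequentially closed subspace of [X^*] (dominated
   convergence and Banach-Steinhaus) that contains [psi o T] for every [psi] in
   [Y^*], hence separates points; by property (D') it is all of [X^*].  Finally,
   a scalar measurable function whose integrals over small sets agree with a
   countably additive real measure is integrable, which glues the pieces. *)
Require Import Defs.
From HB Require Import structures.
From mathcomp Require Import all_boot all_order all_algebra.
From mathcomp Require Import finmap.
From mathcomp Require Import all_classical all_reals all_analysis.
From mathcomp Require Import measurable_realfun lra.
Import Order.TTheory GRing.Theory Num.Theory.
Import numFieldNormedType.Exports.

Set Implicit Arguments.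
Unset Strict Implicit.
Unset Printing Implicit Defensive.

Local Open Scope classical_set_scope.
Local Open Scope ring_scope.

(** * Separation of points by the dual *)

Section Separation.
Context {R : realType} {Y : normedModType R}.
Implicit Types (p q : Y -> R) (a x y : Y).

(** Homogeneity is required only as an inequality, since applying it to the inverse scalar gives the
    other one. Domination by the norm makes every linear member continuous. *)
Definition norm_sublinear p :=
  [/\ forall x y, p (x + y) <= p x + p y,
      forall t x, 0 < t -> p (t *: x) <= t * p x
    & forall x, p x <= `|x|].

Lemma norm_sublinear0 p : norm_sublinear p -> p 0 = 0.
Proof.
move=> [pD pZ _]; apply/le_anti/andP; split.
  by have := pZ 2^-1 0 ltac:(by rewrite invr_gt0); rewrite scaler0; lra.
by have := pZ 2 0 (ltr0Sn _ _); rewrite scaler0; lra.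
Qed.

Lemma norm_sublinearZ p t x : norm_sublinear p -> 0 <= t ->
  p (t *: x) = t * p x.
Proof.
move=> sp; rewrite le_eqVlt => /predU1P[<-|t0].
  by rewrite scale0r mul0r norm_sublinear0.
have [_ pZ _] := sp; apply/le_anti; rewrite pZ//=.
rewrite -ler_pdivlMl// -{1}(scalerK (lt0r_neq0 t0) x).
by rewrite pZ// invr_gt0.
Qed.

Lemma norm_sublinear_ge p x y : norm_sublinear p -> - p (- x) <= p x.
Proof.
move=> sp; have [pD _ _] := sp.
by have := pD x (- x); rewrite subrr norm_sublinear0//; lra.
Qed.

(* A minimal sublinear functional equals its tilt in every direction [a], and
   this equality says that it is additive. *)
Definition tilt p a x := inf [set p (x + t *: a) - t * p a | t in [set t | 0 <= t]].

Lemma tilt_lbound p a x : norm_sublinear p ->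
  lbound [set p (x + t *: a) - t * p a | t in [set t | 0 <= t]] (- p (- x)).
Proof.
move=> sp _ [t /= t0 <-]; have [pD _ _] := sp.
by have := pD (x + t *: a) (- x); rewrite addrAC subrr add0r norm_sublinearZ//; lra.
Qed.

Lemma tilt_le p a x t : norm_sublinear p -> 0 <= t ->
  tilt p a x <= p (x + t *: a) - t * p a.
Proof.
by move=> sp t0; apply: ge_inf; [exists (- p (- x)); exact: tilt_lbound|exists t].
Qed.

Lemma tilt_ge p a x m :
  (forall t, 0 <= t -> m <= p (x + t *: a) - t * p a) -> m <= tilt p a x.
Proof.
move=> h; apply: lb_le_inf; first by exists (p (x + 0 *: a) - 0 * p a), 0 => /=.
by move=> _ [t t0 <-]; exact: h.
Qed.

Lemma tilt_le_id p a x : norm_sublinear p -> tilt p a x <= p x.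
Proof.
by move=> sp; have := tilt_le a x sp (lexx 0); rewrite scale0r addr0 mul0r subr0.
Qed.

(** Parameters [t] for [x] and [s] for [y] combine into the admissible [t + s] for [x + y]; for
    homogeneity the parameter is rescaled along with [x]. *)
Lemma tilt_norm_sublinear p a : norm_sublinear p -> norm_sublinear (tilt p a).
Proof.
move=> sp; have [pD pZ pN] := sp; split.
- move=> x y; rewrite -lerBlDr; apply: tilt_ge => t t0.
  rewrite lerBlDl -lerBlDr; apply: tilt_ge => s s0.
  rewrite lerBlDl.
  apply: (le_trans (tilt_le a _ sp (addr_ge0 t0 s0))).
  have := pD (x + t *: a) (y + s *: a).
  by rewrite addrACA -scalerDl mulrDl; lra.
- move=> c x c0; rewrite -ler_pdivrMl//; apply: tilt_ge => t t0.
  rewrite ler_pdivrMl//.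
  apply: (le_trans (tilt_le a _ sp (mulr_ge0 (ltW c0) t0))).
  rewrite -scalerA -scalerDr norm_sublinearZ//; last exact: ltW.
  by rewrite mulrBr mulrA.
- by move=> x; apply: le_trans (pN x); exact: tilt_le_id.
Qed.

(** Lower bounds of chains, for Zorn's lemma. Subadditivity holds because of two members [p] and [q]
    the smaller one serves for both [x] and [y]. *)
Lemma inf_chain_norm_sublinear (C : set (Y -> R)) : C !=set0 ->
  C `<=` norm_sublinear ->
  (forall p q, C p -> C q -> (forall x, p x <= q x) \/ (forall x, q x <= p x)) ->
  norm_sublinear (fun x => inf [set p x | p in C]) /\
  forall p x, C p -> inf [set q x | q in C] <= p x.
Proof.
move=> [p0 Cp0] Csub Ctot.
have lbC x : lbound [set p x | p in C] (- `|x|).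
  move=> _ [p Cp <-]; have sp := Csub _ Cp; have [_ _ /(_ (- x))] := sp.
  by rewrite normrN => pN; apply: le_trans (norm_sublinear_ge _ x sp); rewrite lerN2.
have infle p x : C p -> inf [set q x | q in C] <= p x.
  by move=> Cp; apply: ge_inf; [exists (- `|x|); exact: lbC|exists p].
have infge x m : (forall p, C p -> m <= p x) -> m <= inf [set q x | q in C].
  by move=> h; apply: lb_le_inf; [exists (p0 x), p0|move=> _ [p Cp <-]; exact: h].
split; last by []. split.
- move=> x y; rewrite -lerBlDr; apply: (infge _ _) => p Cp.
  rewrite lerBlDl -lerBlDr; apply: (infge _ _) => q Cq; rewrite lerBlDl.
  have [pq|qp] := Ctot p q Cp Cq.
    apply: (le_trans (infle p _ Cp)); have [pD _ _] := Csub _ Cp.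
    by apply: (le_trans (pD _ _)); rewrite lerD2l.
  apply: (le_trans (infle q _ Cq)); have [pD _ _] := Csub _ Cq.
  by apply: (le_trans (pD _ _)); rewrite lerD2r.
- move=> c x c0; rewrite -ler_pdivrMl//; apply: (infge _ _) => p Cp.
  rewrite ler_pdivrMl//; have [_ pZ _] := Csub _ Cp.
  by apply: le_trans (pZ _ _ c0); exact: infle.
- by move=> x; have [_ _ pN] := Csub _ Cp0; apply: le_trans (pN x); exact: infle.
Qed.

Lemma minimal_norm_sublinear p : norm_sublinear p ->
  exists2 q, norm_sublinear q /\ (forall x, q x <= p x) &
    forall r, norm_sublinear r -> (forall x, r x <= q x) -> r = q.
Proof.
move=> sp.
pose P : set (Y -> R) := [set q | norm_sublinear q /\ (forall x, q x <= p x)].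
pose T := {q | P q}.
(* The order is reversed, so that a maximal element for [rel] is a minimal functional. *)
pose rel (s t : T) := `[< forall x, sval t x <= sval s x >].
have [||A Atot|[q [sq qp]] qmin] := @ZL_preorder T (exist P p (conj sp (fun=> lexx _))) rel.
- by move=> t; apply/asboolP.
- move=> r s t /asboolP rs /asboolP st; apply/asboolP => x.
  exact: le_trans (st x) (rs x).
- have [[s0 As0]|/forallNP nA] := pselect (A !=set0); last first.
    (* The empty chain is bounded by [p] itself. *)
    by exists (exist P p (conj sp (fun=> lexx _))) => s /nA.
  have [| | |sinf infle] := @inf_chain_norm_sublinear [set sval s | s in A].
  + by exists (sval s0), s0.
  + by move=> _ [[s [ss sp']] _ <-].
  + by move=> _ _ [s As <-] [t At <-];
      have [/asboolP|/asboolP] := Atot _ _ As At; [right|left].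
  + have infp x : inf [set q x | q in [set sval s | s in A]] <= p x.
      by apply: le_trans (infle _ x (imageP _ As0)) _; exact: (svalP s0).2.
    exists (exist P _ (conj sinf infp)) => s As; apply/asboolP => x /=.
    by apply: infle; exists s.
- exists q => // r sr rq; apply/funext => x; apply/le_anti; rewrite rq/=.
  have rp y : r y <= p y by apply: le_trans (rq y) (qp y).
  have := qmin (exist P r (conj sr rp)) _.
  by move=> /(_ _)/asboolP; apply; exact/asboolP.
Qed.

(** Take a minimal [q] below the tilt of the norm in direction [y]. By minimality [tilt q a = q],
    and parameter 1 then gives [q x + q a <= q (x + a)], so [q] is additive. At [- y] the tilted
    norm is at most [- |y|], whence [q y] is nonzero. *)
Lemma dual_separates y : y != 0 -> exists2 f, dual Y f & f y != 0.
Proof.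
move=> y0.
have sN : norm_sublinear (fun x : Y => `|x|).
  split=> // [|t x t0]; first exact: ler_normD.
  by rewrite normrZ gtr0_norm.
have [q [sq qp] qmin] := minimal_norm_sublinear (tilt_norm_sublinear y sN).
have [qD qZ qN] := sq.
have qadd x a : q (x + a) = q x + q a.
  apply/le_anti; rewrite qD/=.
  have := tilt_le a x sq ler01.
  rewrite (qmin _ (tilt_norm_sublinear a sq)); last by move=> z; exact: tilt_le_id.
  by rewrite scale1r mul1r; lra.
have qopp x : q (- x) = - q x.
  by apply/eqP; rewrite -addr_eq0 -qadd addNr norm_sublinear0.
have linq : linear (q : Y -> R^o).
  move=> t x z; rewrite qadd; congr (_ + _).
  have [t0|t0] := leP 0 t; first exact: norm_sublinearZ.
  rewrite -[t]opprK scaleNr qopp norm_sublinearZ//; last by rewrite oppr_ge0 ltW.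
  by rewrite scaleNr.
pose L := GRing.isLinear.Build R Y R^o *:%R (q : Y -> R^o) linq.
pose F : {linear Y -> R^o} := HB.pack (q : Y -> R^o) L.
exists (q : Y -> R^o); last first.
  have : q (- y) <= - `|y|.
    apply: le_trans (qp _) _; apply: (le_trans (tilt_le y _ sN ler01)).
    by rewrite scale1r mul1r addNr normr0 sub0r.
  rewrite qopp lerN2; apply: contraTN => /eqP ->.
  by rewrite -ltNge normr_gt0.
split=> //; apply: (@bounded_linear_continuous _ _ _ F).
apply/linear_boundedP; near=> r => x.
have r1 : 1 <= r by near: r; exact: nbhs_pinfty_ge.
have -> : F x = q x by [].
rewrite ler_norml; apply/andP; split.
  rewrite lerNl -qopp; apply: (le_trans (qN _)); rewrite normrN.
  by rewrite ler_peMl.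
by apply: (le_trans (qN _)); rewrite ler_peMl.
Unshelve. all: by end_near. Qed.

End Separation.

(** * Property (D') *)

Lemma continuous_linear_norm_bound {R : realType} {X Y : normedModType R}
    (L : {linear X -> Y}) : continuous L ->
  exists2 M, 0 < M & forall x, `|L x| <= M * `|x|.
Proof.
move=> cL; have /linear_boundedP[M [_ HM]] : bounded_near L (nbhs (0 : X)).
  by apply: continuous_linear_bounded; exact: cL.
exists (Num.max M 0 + 1); first by rewrite ltr_wpDl// le_max lexx orbT.
by move=> x; apply: HM; rewrite ltr_pwDr// le_max lexx.
Qed.

Section Dual.
Context {R : realType} {X : normedModType R}.
Implicit Types (f g h : X -> R^o) (S : set (X -> R^o)).

Lemma dual_linear f : dual X f -> exists F : {linear X -> R^o}, f = F.
Proof.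
move=> [lf _]; pose L := GRing.isLinear.Build R X R^o *:%R f lf.
by exists (HB.pack f L : {linear X -> R^o}).
Qed.

Lemma dual_bounded f : dual X f ->
  exists2 M, 0 < M & forall x, `|f x| <= M * `|x|.
Proof.
move=> df; have [F fF] := dual_linear df; have [_] := df; rewrite fF => cF.
exact: continuous_linear_norm_bound.
Qed.

Lemma ptws_seq_cvgP (u : nat -> X -> R^o) f :
  {ptws, u @ \oo --> f} <-> forall x, (u n x : R^o) @[n --> \oo] --> f x.
Proof. by split=> [/pointwise_cvgP|] h; [exact: h|exact/pointwise_cvgP]. Qed.

Lemma dual_norm_ge f x : dual X f -> `|f x| <= dual_norm f * `|x|.
Proof.
move=> df; have [M M0 fM] := dual_bounded df; have [F fF] := dual_linear df.
have [->|x0] := eqVneq x 0; first by rewrite fF linear0 !normr0 mulr0.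
rewrite -ler_pdivrMr ?normr_gt0//; apply: ub_le_sup.
  exists M => _ [z /= z1 <-]; apply: (le_trans (fM z)).
  by rewrite ler_piMr// ltW.
exists (`|x|^-1 *: x) => /=.
  by rewrite /unit_ball/= normrZ normfV normr_id mulVf ?normr_eq0.
by rewrite fF linearZ/= normrM normfV normr_id mulrC.
Qed.

(** Approximants within [1 / (n + 1)] in dual norm converge pointwise, hence form a weak* convergent
    sequence. *)
Lemma seq_closed_norm_closed S : S `<=` dual X ->
  (forall a f g, S f -> S g -> S (a *: f + g)) ->
  weak_star_seq_closed S -> norm_closed S.
Proof.
move=> Sd Slin Sseq f df fS.
have /choice[u uP] n : exists g, S g /\ dual_norm (f - g) < n.+1%:R^-1.
  by have [g Sg fg] := fS n.+1%:R^-1 ltac:(by []); exists g.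
apply: (Sseq u) => [n|//|]; first by have [] := uP n.
apply/ptws_seq_cvgP => x; apply/cvgrPdist_lt => e e0.
have dfu n : dual X (f - u n).
  have [lf cf] := df; have [lu cu] := Sd _ (uP n).1.
  split=> [a y z|y]; last exact: (continuousB (cf y) (cu y)).
  by rewrite !fctE lf lu scalerBr opprD addrACA.
(* Adding 1 keeps the divisor positive when [x = 0]. *)
have xx : 0 < `|x| + 1 by rewrite ltr_wpDl.
near=> n; have [_ un] := uP n.
have := dual_norm_ge x (dfu n).
move=> /le_lt_trans; apply.
apply: (@le_lt_trans _ _ (n.+1%:R^-1 * `|x|)).
  by rewrite ler_wpM2r// ltW.
have ne : n.+1%:R^-1 < e / (`|x| + 1).
  by near: n; exact: (near_infty_natSinv_lt (PosNum (divr_gt0 e0 xx))).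
apply: (@le_lt_trans _ _ (n.+1%:R^-1 * (`|x| + 1))); last by rewrite -ltr_pdivlMr.
by rewrite ler_wpM2l// lerDl.
Unshelve. all: by end_near. Qed.

(** * Weak* density of separating subspaces of the dual *)

Section separating.
Variable S : set (X -> R^o).
Hypothesis Slin : linear_subspace S.
Hypothesis Ssep : forall x, (forall f, S f -> f x = 0) -> x = 0.

Let scE (a : R) (b : R^o) : a *: b = a * (b : R) :> R. Proof. by []. Qed.

(** Since [S] separates points, the hypothesis amounts to [x] lying in the span of [s]. Induction on
    [s]: a head [z] killed by every [h] in [S] that vanishes on the tail is redundant; otherwise
    some such [h] has [h z != 0], and [x] is replaced by its projection to the kernel of [h] along
    [z]. *)
Lemma separating_span (s : seq X) x :
  (forall h, S h -> {in s, forall z, h z = 0} -> h x = 0) ->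
  forall f, dual X f -> {in s, forall z, f z = 0} -> f x = 0.
Proof.
have [Sd S0 SZD] := Slin.
elim: s x => [|z s IH] x hx f df fs.
  rewrite (Ssep (x := x)); last by move=> h Sh; exact: hx.
  by have [F ->] := dual_linear df; rewrite linear0.
have fs' : {in s, forall y, f y = 0}.
  by move=> y ys; apply: fs; rewrite inE ys orbT.
have [hz|] := pselect (forall h, S h -> {in s, forall y, h y = 0} -> h z = 0).
  apply: IH => // h Sh hs; apply: hx => // y.
  by rewrite inE => /orP[/eqP->|]; [exact: hz|exact: hs].
move=> /existsNP[h /not_implyP[Sh /not_implyP[hs /eqP hz]]].
have [H hH] := dual_linear (Sd _ Sh).
have [F fF] := dual_linear df.
have fz : f z = 0 by apply: fs; rewrite inE eqxx.
suff : f (x - (h x / h z) *: z) = 0.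
  by rewrite fF linearB linearZ -fF/= fz scaler0 subr0.
apply: IH => // g Sg gs.
have [G gG] := dual_linear (Sd _ Sg).
(* This combination is in [S], vanishes on the tail, and its coefficient makes it vanish at [z] as
   well. *)
have : ((- (g z / h z)) *: h + g) x = 0.
  apply: hx; first exact: SZD.
  move=> y; rewrite inE => /orP[/eqP->|ys]; rewrite !fctE.
    by rewrite scE mulNr divfK// addNr.
  by rewrite (hs y)// (gs y)// scaler0 addr0.
rewrite !fctE => gx; rewrite gG linearB linearZ -gG/=.
rewrite -[RHS]gx [RHS]addrC !scE mulNr; congr (_ - _).
by rewrite mulrAC [RHS]mulrAC [h x * _]mulrC.
Qed.

(** A new point [x] is handled by adding a multiple of some [h] in [S] that vanishes on [s] but not
    at [x]. If there is none, [separating_span] applied to [f - g] shows that [g] already agrees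
    with [f] at [x]. *)
Lemma separating_interpolation f (s : seq X) : dual X f ->
  exists2 g, S g & {in s, g =1 f}.
Proof.
have [Sd S0 SZD] := Slin.
move=> df; elim: s => [|x s [g Sg gs]]; first by exists 0.
have dfg : dual X (f - g).
  have [lf cf] := df; have [lu cu] := Sd _ Sg.
  split=> [a y z|y]; last exact: (continuousB (cf y) (cu y)).
  by rewrite !fctE lf lu scalerBr opprD addrACA.
have [hx|] := pselect (forall h, S h -> {in s, forall y, h y = 0} -> h x = 0).
  exists g => // y; rewrite inE => /orP[/eqP->|]; last exact: gs.
  apply/esym/eqP; rewrite -subr_eq0; apply/eqP.
  apply: (separating_span hx dfg) => z zs.
  by rewrite -[LHS]/(f z - g z) gs// subrr.
move=> /existsNP[h /not_implyP[Sh /not_implyP[hs /eqP hx]]].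
exists (((f x - g x) / h x) *: h + g); first exact: SZD.
move=> y; rewrite inE => /orP[/eqP->|ys]; rewrite !fctE.
  by rewrite scE divfK// subrK.
by rewrite (hs y)// scaler0 add0r (gs y).
Qed.

(** Interpolants on finite lists form a filter base on [S] that converges pointwise to [f], so [f]
    is in the weak* closure. *)
Lemma separating_weak_star_closed : weak_star_closed S -> dual X `<=` S.
Proof.
have [Sd S0 SZD] := Slin.
move=> Scl f df; apply: Scl => V Vf.
pose B (s : seq X) := [set g | S g /\ {in s, g =1 f}].
have FB : Filter (filter_from setT B).
  apply: filter_from_filter; first by exists [::].
  move=> s t _ _; exists (s ++ t) => // g [Sg gst].
  by split; split=> // x xs; apply: gst; rewrite mem_cat xs ?orbT.
have Bf : {ptws, filter_from setT B --> f}.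
  apply/pointwise_cvgP => x; apply: (@cvg_trans _ (nbhs (f x))) => //.
  move=> U Uf; exists [:: x] => // g [_ gx] /=.
  by rewrite gx ?inE//; exact: nbhs_singleton.
have := @nbhs_subspace_in {ptws X -> R^o} (dual X) f df => E.
move: Vf; rewrite /nbhs/= -[X in X V]E => /Bf[s _ BV].
have [g Sg gs] := separating_interpolation s df.
by exists g; split=> //; apply: BV => //; exact: Sd.
Qed.

End separating.

Lemma property_D'_separating S : property_D' X -> linear_subspace S ->
  (forall x, (forall f, S f -> f x = 0) -> x = 0) ->
  weak_star_seq_closed S -> dual X `<=` S.
Proof.
move=> D' Slin Ssep Sseq; apply: separating_weak_star_closed => //.
apply: D' => //; have [Sd _ SZD] := Slin; exact: seq_closed_norm_closed.
Qed.

End Dual.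

(** * Vector measures *)

Section VectorMeasure.
Context {d : measure_display} {T : measurableType d} {R : realType}.
Context {X : normedModType R}.
Implicit Types (I : set T -> X) (A B E : set T).

(** For the constant sequence of empty sets the series converges, so its constant term tends to
    0. *)
Lemma countably_additive0 I : countably_additive I -> I set0 = 0.
Proof.
move=> Iadd; have := Iadd (fun=> set0) (fun=> measurable0) (@trivIset_set0 _ _ _).
move=> /(@cvgP _ _)/cvg_series_cvg_0 I0.
have /cvg_lim <- // : I set0 @[_ --> \oo] --> I set0 by exact: cvg_cst.
by rewrite -(cvg_lim _ I0).
Qed.

Lemma countably_additiveU I A B : countably_additive I ->
  measurable A -> measurable B -> A `&` B = set0 -> I (A `|` B) = I A + I B.
Proof.
move=> Iadd mA mB AB0.
have mF n : measurable (bigcup2 A B n).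
  by rewrite /bigcup2; case: ifP => // _; case: ifP => // _; exact: measurable0.
have tF : trivIset setT (bigcup2 A B) by rewrite -trivIset_bigcup2.
have := Iadd _ mF tF; rewrite bigcup2E => h.
rewrite -(cvg_lim _ h)//; apply: cvg_lim => //.
(* All sets of [bigcup2 A B] from index 2 on are empty, so the partial sums are constant from
   there. *)
apply: cvg_near_cst; exists 2%N => // n /= n2.
rewrite -(subnKC n2) seriesEnat/= (@big_cat_nat _ _ _ 2)//=.
rewrite [X in _ + X]big_nat_cond [X in _ + X]big1 ?addr0; last first.
  move=> i; rewrite andbT => /andP[i2 _].
  by case: i i2 => [|[|i]]//= _; rewrite countably_additive0.
by rewrite big_nat_recl// big_nat1.
Qed.

(** The variation ranges over exact partitions of [E]; the remainder [E \ U] is added as an extra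
    piece, in position [ord0], and can only increase the sum. *)
Lemma vector_variation_ge I E n (F : 'I_n -> set T) : measurable E ->
  (forall i, measurable (F i)) -> trivIset setT F -> (forall i, F i `<=` E) ->
  ((\sum_(i < n) `|I (F i)|)%:E <= vector_variation I E)%E.
Proof.
move=> mE mF tF FE; set U := \bigcup_i F i.
have mU : measurable U by apply: fin_bigcup_measurable.
pose G (i : 'I_n.+1) := if unlift ord0 i is Some j then F j else E `\` U.
have G0 : G ord0 = E `\` U by rewrite /G unlift_none.
have GS i : G (lift ord0 i) = F i by rewrite /G liftK.
have GU i : F i `&` (E `\` U) = set0.
  by apply/seteqP; split=> // x [Fx [_]]; apply; exists i.
apply: (@le_trans _ _ (\sum_(i < n.+1) `|I (G i)|)%:E).
  rewrite lee_fin big_ord_recl; under [in leRHS]eq_bigr do rewrite GS.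
  by rewrite lerDr.
apply: ereal_sup_ubound; exists n.+1, G; split=> //.
- by move=> i; case: (unliftP ord0 i) => [j|] ->; rewrite ?GS ?G0//; exact: measurableD.
- move=> i j _ _; case: (unliftP ord0 i) => [i'|] ->;
    case: (unliftP ord0 j) => [j'|] ->; rewrite ?GS ?G0//.
  + by move=> /tF->.
  + by rewrite GU => /set0P; rewrite eqxx.
  + by rewrite setIC GU => /set0P; rewrite eqxx.
- apply/seteqP; split=> [x [i _]|x Ex].
    by case: (unliftP ord0 i) => [j|] ->; rewrite ?GS ?G0; [exact: FE|case].
  have [[i _ Fx]|nUx] := pselect (U x); first by exists (lift ord0 i); rewrite ?GS.
  by exists ord0; rewrite ?G0.
Qed.

Lemma vector_variation_restrict I E :  measurable E ->
  (vector_variation (fun A => I (A `&` E)) setT <= vector_variation I E)%E.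
Proof.
move=> mE; apply: ub_ereal_sup => _ [n [F [mF tF FT ->]]].
apply: vector_variation_ge => //.
- by move=> i; exact: measurableI.
- exact: trivIset_setIr.
Qed.

Lemma le_vector_variation I A E : measurable E -> A `<=` E ->
  (vector_variation I A <= vector_variation I E)%E.
Proof.
move=> mE AE; apply: ub_ereal_sup => _ [n [F [mF tF FA ->]]].
apply: vector_variation_ge => // i; apply: subset_trans AE.
by rewrite -FA; exact: bigcup_sup.
Qed.

Lemma countably_additive_restrict I E : measurable E ->
  countably_additive I -> countably_additive (fun A => I (A `&` E)).
Proof.
move=> mE Iadd F mF tF; rewrite setI_bigcupl; apply: Iadd.
- by move=> n; exact: measurableI.
- exact: trivIset_setIr.
Qed.

End VectorMeasure.

Lemma countably_additive_comp {d} {T : measurableType d} {R : realType}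
    {X Y : normedModType R} (I : set T -> X) (f : {linear X -> Y}) :
  continuous f -> countably_additive I -> countably_additive (f \o I).
Proof.
move=> cf Iadd F mF tF; have /(continuous_cvg _ (cf _)) := Iadd F mF tF.
apply: cvg_trans; apply: near_eq_cvg; near=> n.
by rewrite /= !seriesEnat/= linear_sum.
Unshelve. all: by end_near. Qed.

(** * Integrability from agreement with a countably additive real measure *)

Section Patching.
Context {d : measure_display} {T : measurableType d} {R : realType}.
Variable nu : {measure set T -> \bar R}.

Lemma ge0_integral_countably_additive (mu : set T -> R^o) (C : (set T)^nat)
    (f : T -> R) A : countably_additive mu ->
  (forall k, measurable (C k)) -> trivIset setT C -> \bigcup_k C k = setT ->
  measurable A -> measurable_fun A f -> (forall x, A x -> 0 <= f x) ->
  (forall k, \int[nu]_(x in A `&` C k) (f x)%:E = (mu (A `&` C k))%:E)%E ->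
  (\int[nu]_(x in A) (f x)%:E = (mu A)%:E)%E.
Proof.
move=> muadd mC tC CT mA mf f0 fC.
have mAC k : measurable (A `&` C k) by exact: measurableI.
have tAC : trivIset setT (fun k => A `&` C k) by exact: trivIset_setIl.
have AE : A = \bigcup_k (A `&` C k) by rewrite -setI_bigcupr CT setIT.
rewrite {1}AE ge0_integral_bigcup//=; last 2 first.
- by rewrite -AE; exact/measurable_EFinP.
- by rewrite -AE => x Ax; rewrite lee_fin f0.
under eq_eseriesr do rewrite fC.
apply/cvg_lim => //; rewrite {2}AE.
have := muadd _ mAC tAC.
move=> mucvg; apply: cvg_EFin; first by apply: nearW => n; rewrite sumEFin.
by apply: cvg_trans mucvg; apply: near_eq_cvg; near=> n; rewrite /= sumEFin.
Unshelve. all: by end_near. Qed.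

(** Where [f] has constant sign, monotone convergence over the disjointified pieces gives the
    integral as a value of [mu] or [- mu]. These values are finite real numbers, so both parts of
    [f] have finite integral and [f] is integrable. *)
Lemma integral_countably_additive (mu : set T -> R^o) (C : (set T)^nat)
    (f : T -> R) : countably_additive mu ->
  (forall k, measurable (C k)) -> \bigcup_k C k = setT ->
  measurable_fun setT f -> (forall k, nu.-integrable (C k) (EFin \o f)) ->
  (forall k A, measurable A -> A `<=` C k -> \int[nu]_(x in A) f x = mu A) ->
  nu.-integrable setT (EFin \o f) /\
  forall A, measurable A -> \int[nu]_(x in A) f x = mu A.
Proof.
move=> muadd mC CT mf fC fmu.
have mD := seqDU_measurable mC; have tD := @trivIset_seqDU _ C.
have DT : \bigcup_k seqDU C k = setT by rewrite -seqDU_bigcup_eq.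
have DC k : seqDU C k `<=` C k by exact: subDsetl.
have fmuD k A : measurable A -> (\int[nu]_(x in A `&` seqDU C k) (f x)%:E)%E =
    (mu (A `&` seqDU C k))%:E.
  move=> mA; have mAD : measurable (A `&` seqDU C k) by exact: measurableI.
  have AD : A `&` seqDU C k `<=` C k by move=> x [_ /DC].
  rewrite -(fmu _ _ mAD AD) fineK//; apply: integrable_fin_num => //.
  exact: integrableS (fC k).
have muNadd : countably_additive (fun A => - mu A : R^o).
  apply: (@countably_additive_comp _ _ _ R^o R^o mu -%R) => //.
  exact: opp_continuous.
pose P := [set x | 0 <= f x].
have mP : measurable P.
  rewrite -[P]setTI (_ : P = f @^-1` `[0, +oo[); first exact: mf.
  by apply/seteqP; split=> x /=; rewrite in_itv/= andbT.
have fP A : measurable A -> A `<=` P -> (\int[nu]_(x in A) (f x)%:E = (mu A)%:E)%E.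
  move=> mA AP; apply: (ge0_integral_countably_additive muadd mD) => //.
  - exact: (measurable_funS measurableT).
  - by move=> k; exact: fmuD.
have fN A : measurable A -> A `<=` ~` P -> (\int[nu]_(x in A) (- f x)%:E = (- mu A)%:E)%E.
  move=> mA AP; apply: (ge0_integral_countably_additive muNadd mD) => //.
  - by apply: measurableT_comp => //; apply: (measurable_funS measurableT).
  - by move=> x /AP /negP; rewrite -ltNge oppr_ge0 => /ltW.
  - move=> k; rewrite -[RHS]/(- (mu (A `&` seqDU C k))%:E)%E -fmuD//.
    under eq_integral do rewrite EFinN.
    rewrite integralN//; apply: integrable_add_def; first exact: measurableI.
    apply: integrableS (fC k) => //; first exact: measurableI.
    by move=> x [_ /DC].
have intf : nu.-integrable setT (EFin \o f).
  apply/integrableP; split; first exact/measurable_EFinP.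
  rewrite -(setUv P) ge0_integral_setU//=; last 3 first.
  - exact: measurableC.
  - by rewrite setUv; apply/measurable_EFinP; exact: measurableT_comp.
  - by apply/disj_setPS; rewrite setICr.
  rewrite (eq_integral (fun x => (f x)%:E)); last first.
    by move=> x; rewrite inE => Px; rewrite ger0_norm.
  rewrite [X in (_ + X)%E](eq_integral (fun x => (- f x)%:E)); last first.
    by move=> x; rewrite inE => /negP; rewrite -ltNge => /ltr0_norm ->.
  by rewrite fP// fN//; [rewrite -EFinD ltry|exact: measurableC].
split=> // A mA.
have [mAP mAN] : measurable (A `&` P) /\ measurable (A `&` ~` P).
  by split; apply: measurableI => //; exact: measurableC.
have APN : A `&` P `&` (A `&` ~` P) = set0 by rewrite setIACA setICr setI0.
have intN : nu.-integrable (A `&` ~` P) (EFin \o f) by exact: integrableS intf.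
have AE : A = (A `&` P) `|` (A `&` ~` P) by rewrite -setIUr setUv setIT.
rewrite {2}AE countably_additiveU// {1}AE Rintegral_setU//; last 2 first.
- by rewrite -AE; exact: integrableS intf.
- by apply/disj_setPS; rewrite APN.
congr (_ + _); first by rewrite /Rintegral fP.
have := fN _ mAN (@subIsetr _ _ _); under eq_integral do rewrite EFinN.
rewrite integralN//; last exact: integrable_add_def.
by rewrite EFinN => /oppe_inj; rewrite /Rintegral => ->.
Qed.

End Patching.

(** * Bochner integral *)

Section AlmostEverywhere.
Context {d : measure_display} {T : measurableType d} {R : realType}.
Variable nu : {measure set T -> \bar R}.
Hypothesis nu_complete : measure_is_complete nu.

(** After multiplication by the indicator of the complement of a null set, convergence holds
    everywhere; completeness carries measurability back to [v]. *)
Lemma ae_cvg_measurable_fun (u : nat -> T -> R) (v : T -> R) :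
  (forall n, measurable_fun setT (u n)) ->
  {ae nu, forall w, u ^~ w @ \oo --> v w} -> measurable_fun setT v.
Proof.
move=> mu [N [mN N0 Nu]].
have mv' : measurable_fun setT (fun w => v w * \1_(~` N) w).
  apply: (@measurable_fun_cvg _ _ _ _ (fun n w => u n w * \1_(~` N) w)) => [n|w _].
    apply: measurable_funM => //; apply: measurable_indic; exact: measurableC.
  have [Nw|Nw] := pselect (N w).
    have -> : \1_(~` N) w = 0 :> R by rewrite indicE memNset// => /(_ Nw).
    by rewrite mulr0; under eq_fun do rewrite mulr0; exact: cvg_cst.
  by apply: cvgMl; apply: contrapT => h; exact/Nw/Nu.
apply/measurable_EFinP; move/measurable_EFinP : mv'; apply: (ae_measurable_fun nu_complete).
exists N; split=> // w /= h; apply: contrapT => Nw; apply: h => _.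
by rewrite /= indicE mem_set ?mulr1.
Qed.

End AlmostEverywhere.

(** * Integrals of simple functions *)

Section SimpleFunctions.
Context {d : measure_display} {T : measurableType d} {R : realType}.
Context {Y : normedModType R}.
Implicit Types (s : T -> Y) (A : set T).

(** The preimage splits into finitely many parts according to the value of [s]. The second argument
    of [k] allows for functions such as [|s w - g w|]. *)
Lemma simple_measurable_comp s (k : Y -> T -> R) : simple_function s ->
  (forall x, measurable_fun setT (k x)) -> measurable_fun setT (fun w => k (s w) w).
Proof.
move=> [fs ms] mk _ B mB; rewrite setTI.
rewrite (_ : _ @^-1` _ = \bigcup_(x in range s) (s @^-1` [set x] `&` k x @^-1` B)).
  apply: fin_bigcup_measurable => // x _; apply: measurableI; first exact: ms.
  by rewrite -[X in measurable X]setTI; exact: mk.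
apply/seteqP; split=> [w Bw|w [x _ [/= -> //]]].
by exists (s w).
Qed.

Variable nu : probability T R.

Lemma simple_integrable s (h : Y -> R) A : measurable A ->
  simple_function s -> nu.-integrable A (EFin \o (h \o s)).
Proof.
move=> mA [fs ms]; apply: measurable_bounded_integrable => //.
- by rewrite (le_lt_trans (probability_le1 _ mA))// ltry.
- apply: measurable_funS (simple_measurable_comp (k := fun x _ => h x) _ _) => //.
(* The sum over the finite range is a bound that works for any [h]. *)
- exists (\sum_(x <- fset_set (range s)) `|h x|); split=> [|r hr w _]/=.
    exact: num_real.
  apply: le_trans (ltW hr).
  rewrite (big_fsetD1 (s w))/=; first by rewrite lerDl sumr_ge0.
  by rewrite in_fset_set//; apply/mem_set; exists w.
Qed.

Lemma Rintegral_simple s (h : Y -> R) A : measurable A -> simple_function s ->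
  \int[nu]_(w in A) h (s w) =
  \sum_(x \in range s) fine (nu (A `&` s @^-1` [set x])) * h x.
Proof.
move=> mA ss; have [fs ms] := ss.
have AE : A = \big[setU/set0]_(x <- fset_set (range s)) (A `&` s @^-1` [set x]).
  rewrite -bigcup_fset fset_setK//.
  apply/seteqP; split=> [w Aw|w [x _ []//]].
  by exists (s w).
have mAs x : measurable (A `&` s @^-1` [set x]) by exact: measurableI.
rewrite /Rintegral {1}AE integral_bigsetU_EFin//; first last.
- rewrite -AE; exact: measurable_int (simple_integrable h mA ss).
- by move=> x y _ _ [w [[_ <-] [_ <-]]].
rewrite fsbig_finite//= -sum_fine/=.
  apply: eq_bigr => x _; rewrite (eq_integral (fun=> (h x)%:E)).
    by rewrite integral_cst// fineM//= ?fin_num_measure// mulrC.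
  by move=> w /set_mem[_ /= ->].
move=> x _; apply: integrable_fin_num => //; exact: (simple_integrable h).
Qed.

Lemma simple_integral_dual s (f : Y -> R^o) A : dual Y f -> measurable A ->
  simple_function s -> f (simple_integral nu A s) = \int[nu]_(w in A) f (s w).
Proof.
move=> df mA ss; have [F fF] := dual_linear df; have [fs ms] := ss.
rewrite (@Rintegral_simple s f)// /simple_integral !fsbig_finite//= fF linear_sum.
by apply: eq_bigr => x _; rewrite linearZ.
Qed.

(** Splitting [nu A] over the same level sets turns the difference into one sum, to which the
    triangle inequality applies. *)
Lemma simple_integral_dist s (y : Y) A : measurable A -> simple_function s ->
  `|simple_integral nu A s - fine (nu A) *: y| <= \int[nu]_(w in A) `|s w - y|.
Proof.
move=> mA ss; have [fs ms] := ss.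
have nuA : fine (nu A) = \sum_(x \in range s) fine (nu (A `&` s @^-1` [set x])).
  have := @Rintegral_simple s (fun=> 1) A mA ss; rewrite Rintegral_cst// mul1r => ->.
  by apply: eq_fsbigr => x _; rewrite mulr1.
rewrite (@Rintegral_simple s (fun x => `|x - y|))// nuA /simple_integral.
rewrite !fsbig_finite//= scaler_suml -sumrB.
apply: (le_trans (ler_norm_sum _ _ _)); apply: ler_sum => x _.
by rewrite -scalerBr normrZ ger0_norm// fine_ge0.
Qed.

End SimpleFunctions.

(** * Scalar consequences and mean value estimate for the Bochner integral *)

Section Bochner.
Context {d : measure_display} {T : measurableType d} {R : realType}.
Context {Y : normedModType R} (nu : probability T R).
Hypothesis nu_complete : measure_is_complete nu.
Implicit Types (s : nat -> T -> Y) (g : T -> Y) (A : set T) (f : Y -> R^o).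

Lemma strongly_measurable_comp g (h : Y -> R) : strongly_measurable nu g ->
  continuous h -> measurable_fun setT (h \o g).
Proof.
move=> [s ss sg] ch.
apply: (ae_cvg_measurable_fun (u := fun n w => h (s n w)) nu_complete).
  by move=> n; exact: (simple_measurable_comp (k := fun x _ => h x)).
by apply: filterS sg => w sgw; exact: (continuous_cvg _ (ch (g w))).
Qed.

Lemma strongly_measurable_dist g y : strongly_measurable nu g ->
  measurable_fun setT (fun w => `|y - g w|).
Proof.
move=> mg; apply: (strongly_measurable_comp (h := fun z => `|y - z|) mg) => z.
by apply: cvg_norm; apply: cvgB; [exact: cvg_cst|exact: cvg_id].
Qed.

(** Convergence to 0 in the extended reals makes the integrals finite only eventually; the bound
    over [setT] then serves every [A]. *)
Lemma simple_L1_cvg_near s g e : strongly_measurable nu g ->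
  simple_L1_cvg nu s g -> 0 < e ->
  \forall n \near \oo, nu.-integrable setT (fun w => `|s n w - g w|%:E) /\
    forall A, measurable A -> \int[nu]_(w in A) `|s n w - g w| < e.
Proof.
move=> mg [ss sg] e0.
have msg n : measurable_fun setT (fun w => `|s n w - g w|).
  apply: (simple_measurable_comp (k := fun x w => `|x - g w|)) => // x.
  exact: strongly_measurable_dist.
have /fine_cvgP[fsg /cvgrPdist_lt/(_ _ e0)] := sg => esg.
near=> n.
have fn : (\int[nu]_w `|s n w - g w|%:E)%E \is a fin_num by near: n.
have en : `|0 - fine (\int[nu]_w `|s n w - g w|%:E)%E| < e by near: n.
have intn : nu.-integrable setT (fun w => `|s n w - g w|%:E).
  apply/integrableP; split; first exact/measurable_EFinP.
  under eq_integral do rewrite /= normr_id.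
  by rewrite -ge0_fin_numE ?integral_ge0.
split=> // A mA; apply: le_lt_trans en.
rewrite sub0r normrN ger0_norm ?fine_ge0 ?integral_ge0//.
apply: fine_le => //.
  apply: integrable_fin_num => //; exact: integrableS intn.
by apply: ge0_subset_integral => //; exact/measurable_EFinP.
Unshelve. all: by end_near. Qed.

Lemma bochner_integrable_dual g f : bochner_integrable nu g -> dual Y f ->
  nu.-integrable setT (EFin \o (f \o g)).
Proof.
move=> [mg [s sg]] df; have [ss _] := sg; have [M M0 fM] := dual_bounded df.
have [F fF] := dual_linear df.
(* A single approximant suffices: [|f g|] is at most [|f s_n| + M |s_n - g|]. *)
have [n _ /(_ n (leqnn n))/= [intn _]] := simple_L1_cvg_near mg sg ltr01.
have mfg : measurable_fun setT (f \o g).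
  by apply: strongly_measurable_comp => //; exact: df.2.
have intM : nu.-integrable setT (fun w => (M%:E * `|s n w - g w|%:E)%E).
  exact: integrableZl.
have ints : nu.-integrable setT (fun w => `|f (s n w)|%:E).
  by apply: (simple_integrable nu (fun x => `|f x|)).
apply: le_integrable (integrableD measurableT ints intM) => //.
  exact/measurable_EFinP.
move=> w _ /=; rewrite lee_fin [leRHS]ger0_norm; last first.
  by rewrite addr_ge0// mulr_ge0// ltW.
have -> : f (g w) = f (s n w) - f (s n w - g w) by rewrite fF linearB opprB addrC subrK.
by apply: (le_trans (ler_normB _ _)); rewrite lerD2l.
Qed.

(** The images under [f] of the simple integrals converge to both sides. *)
Lemma bochner_integral_dual g f A (v : Y) : bochner_integrable nu g -> dual Y f ->
  measurable A -> is_bochner_integral nu A g v -> f v = \int[nu]_(w in A) f (g w).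
Proof.
move=> ig df mA [s sg sv]; have [mg _] := ig; have [ss _] := sg.
have [M M0 fM] := dual_bounded df; have [F fF] := dual_linear df.
have ifg : nu.-integrable A (EFin \o (f \o g)).
  exact: integrableS (bochner_integrable_dual ig df).
have cf : f (simple_integral nu A (s n)) @[n --> \oo] --> f v.
  by apply: continuous_cvg => //; exact: df.2.
apply: (@cvg_unique _ (@Rhausdorff R) _ _ _ _ cf).
apply/cvgrPdist_le => e e0; near=> n.
have [intn /(_ A mA) en] : nu.-integrable setT (fun w => `|s n w - g w|%:E) /\
    forall A, measurable A -> \int[nu]_(w in A) `|s n w - g w| < e / M.
  by near: n; apply: simple_L1_cvg_near => //; rewrite divr_gt0.
have ifs : nu.-integrable A (EFin \o (f \o s n)) by exact: simple_integrable.
rewrite simple_integral_dual// distrC -RintegralB//.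
have intA : nu.-integrable A (fun w => `|s n w - g w|%:E) by exact: integrableS intn.
have intB : nu.-integrable A (EFin \o (fun w => f (s n w) - f (g w))).
  by have := integrableB mA ifs ifg.
apply: (le_trans (le_normr_Rintegral mA intB)).
apply: (@le_trans _ _ (\int[nu]_(w in A) (M * `|s n w - g w|))).
  apply: le_Rintegral => //.
  - exact: integrable_norm.
  - by have := integrableZl mA M intA.
  - by move=> w _; rewrite fF -linearB -fF.
by rewrite RintegralZl// -ler_pdivlMl// mulrC ltW.
Unshelve. all: by end_near. Qed.

(** Limit of [simple_integral_dist], using [|s_n - y| <= r + |s_n - g|] on [A]. *)
Lemma bochner_integral_dist g A (v y : Y) r : strongly_measurable nu g ->
  measurable A -> is_bochner_integral nu A g v ->
  (forall w, A w -> `|g w - y| <= r) ->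
  `|v - fine (nu A) *: y| <= r * fine (nu A).
Proof.
move=> mg mA [s sg sv] gr; have [ss _] := sg.
apply/ler_addgt0Pr => e e0.
have cv : `|simple_integral nu A (s n) - fine (nu A) *: y| @[n --> \oo] -->
    `|v - fine (nu A) *: y|.
  by apply: cvg_norm; apply: cvgB => //; exact: cvg_cst.
have := cvgr_to_le (F := \oo) cv; apply; near=> n.
have [intn /(_ A mA) en] : nu.-integrable setT (fun w => `|s n w - g w|%:E) /\
    forall A, measurable A -> \int[nu]_(w in A) `|s n w - g w| < e.
  by near: n; exact: simple_L1_cvg_near.
apply: (le_trans (simple_integral_dist nu y mA (ss n))).
have intA : nu.-integrable A (fun w => `|s n w - g w|%:E) by exact: integrableS intn.
have intr : nu.-integrable A (fun w => r%:E) by exact: finite_measure_integrable_cst.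
apply: (@le_trans _ _ (\int[nu]_(w in A) (r + `|s n w - g w|))).
  apply: le_Rintegral => //.
  - by apply: (simple_integrable nu (fun x => `|x - y|)).
  - by have := integrableD mA intr intA.
  - move=> w Aw; have -> : s n w - y = (g w - y) + (s n w - g w) by rewrite [RHS]addrC subrKA.
    by apply: (le_trans (ler_normD _ _)); rewrite lerD2r gr.
by rewrite RintegralD// Rintegral_cst// lerD2l ltW.
Unshelve. all: by end_near. Qed.

End Bochner.

(** * The weak Radon-Nikodym property *)

Lemma countable_enum {U : pointedType} (D : set U) : countable D ->
  exists e : nat -> U, D `<=` range e.
Proof.
move=> /countable_injP[f finj].
(* Indices outside the image of [D] get the default [point], which is why [D] is only included in
   the range. *)
exists (fun k => xget point [set y | D y /\ f y = k]) => y Dy.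
exists (f y) => //; case: xgetP => [z _ [Dz fz]|/(_ y)]; last by case.
by apply: finj; rewrite ?inE.
Qed.

(** * Lifting a density through a semi-embedding *)

Section SemiEmbedding.
Context {d : measure_display} {T : measurableType d} {R : realType}.
Context {X Y : normedModType R} (nu : probability T R).
Hypothesis nu_complete : measure_is_complete nu.

(** The centers are the values of the simple approximants and the radii are the [1 / (j + 1)], hence
    countably many balls. *)
Lemma strongly_measurable_separable (g : T -> Y) : strongly_measurable nu g ->
  exists c : nat -> Y * R, {ae nu, forall w, forall e, 0 < e ->
    exists i, `|(c i).1 - g w| <= (c i).2 /\ (c i).2 < e}.
Proof.
move=> [s ss sg].
pose D := \bigcup_n \bigcup_j ((fun y => (y, j.+1%:R^-1)) @` range (s n)) : set (Y * R).
have /countable_enum[c Dc] : countable D.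
  apply: bigcup_countable => [|n _]; first exact: countableP.
  apply: bigcup_countable => [|j _]; first exact: countableP.
  apply: finite_set_countable; apply: finite_image; exact: (ss n).1.
exists c; apply: filterS sg => w sgw e e0.
near \oo => j.
have je : j.+1%:R^-1 < e by near: j; exact: (near_infty_natSinv_lt (PosNum e0)).
have jr : (0 : R) < j.+1%:R^-1 by [].
near \oo => n.
have sn : `|s n w - g w| <= j.+1%:R^-1.
  by rewrite distrC; near: n; exact: (cvgrPdist_le _ _).1 sgw _ jr.
have [i _ ci] : range c (s n w, j.+1%:R^-1).
  by apply: Dc; exists n => //; exists j => //; exists (s n w).
by exists i; rewrite ci.
Unshelve. all: by end_near. Qed.

Variables (L : {linear X -> Y}) (J : set T -> X) (g : T -> Y).
Hypothesis iL : injective L.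
Hypothesis clL : closed (L @` unit_ball X).
Hypothesis Jfin : (vector_variation J setT < +oo)%E.
Hypothesis gm : strongly_measurable nu g.
Hypothesis gJ : forall A, measurable A -> is_bochner_integral nu A g (L (J A)).

(** The image under [L] of the ball of radius [m + 1], written as a preimage so that it is visibly
    closed. *)
Let K (m : nat) := [set y | (L @` unit_ball X) (m.+1%:R^-1 *: y)].

Let closedK m : closed (K m).
Proof.
apply: (@closed_comp _ _ (fun y : Y => m.+1%:R^-1 *: y)) => //.
by move=> y _; exact: scaler_continuous.
Qed.

Let K_image m x : `|x| <= m.+1%:R -> K m (L x).
Proof.
move=> xm; exists (m.+1%:R^-1 *: x); last by rewrite linearZ.
by rewrite /unit_ball/= normrZ ger0_norm// ler_pdivrMl// mulr1.
Qed.

Let imageK m y : K m y -> exists2 x, `|x| <= m.+1%:R & L x = y.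
Proof.
move=> [z z1 Lz]; exists (m.+1%:R *: z).
  by rewrite normrZ ger0_norm// -[leRHS]mulr1 ler_wpM2l.
by rewrite linearZ/= Lz scalerA divff// scale1r.
Qed.

(* [L (J A) / nu A] is the mean of [g] over [A], so it stays in the ball of center
   [c] and radius [r]. *)
Let average_outside m A c r : measurable A ->
  (forall w, A w -> `|c - g w| <= r) -> (forall z, `|c - z| <= r -> ~ K m z) ->
  m.+1%:R * fine (nu A) <= `|J A|.
Proof.
move=> mA gr cK; rewrite leNgt; apply/negP => JA.
(* The strict inequality assumed for contradiction forces positive measure, so the mean of [J] over
   [A] makes sense. *)
have nuA : 0 < fine (nu A).
  by have := le_lt_trans (normr_ge0 _) JA; rewrite pmulr_rgt0.
apply: (cK (L ((fine (nu A))^-1 *: J A))); last first.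
  by apply: K_image; rewrite normrZ gtr0_norm ?invr_gt0// ler_pdivrMl// mulrC ltW.
have h := @bochner_integral_dist _ _ _ _ nu nu_complete g A _ c r gm mA (gJ mA).
rewrite linearZ/=.
have -> : c - (fine (nu A))^-1 *: L (J A) =
    - ((fine (nu A))^-1 *: (L (J A) - fine (nu A) *: c)).
  by rewrite scalerBr scalerA mulVf ?gt_eqF// scale1r opprB.
rewrite normrN normrZ gtr0_norm ?invr_gt0// ler_pdivrMl// mulrC.
by apply: h => w Aw; rewrite distrC gr.
Qed.

Lemma density_ae_in_range : exists2 U : nat -> set T,
  (forall m, measurable (U m)) /\ nu (\bigcap_m U m) = 0 &
  {ae nu, forall w, forall m, ~ U m w -> K m (g w)}.
Proof.
have [c cg] := strongly_measurable_separable gm.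
(* The first condition does not involve [w]: [G m i] is empty unless the ball [c i] misses [K m]. *)
pose G m i := [set w | (forall z, `|(c i).1 - z| <= (c i).2 -> ~ K m z) /\
                       `|(c i).1 - g w| <= (c i).2].
have mG m i : measurable (G m i).
  have [h|h] := pselect (forall z, `|(c i).1 - z| <= (c i).2 -> ~ K m z); last first.
    by rewrite (_ : G m i = set0)//; apply/seteqP; split=> // w [].
  rewrite (_ : G m i = setT `&` (fun w => `|(c i).1 - g w|) @^-1` `]-oo, (c i).2]).
    apply: (strongly_measurable_dist nu_complete (c i).1 gm) => //; exact: measurable_itv.
  by apply/seteqP; split=> w; rewrite /G/= in_itv/= => -[].
have mU m : measurable (\bigcup_i G m i) by exact: bigcup_measurable.
exists (fun m => \bigcup_i G m i); first split=> //.
- have mE : measurable (\bigcap_m \bigcup_i G m i) by exact: bigcap_measurable.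
  have UV m : (m.+1%:R%:E * nu (\bigcap_m \bigcup_i G m i) <= vector_variation J setT)%E.
    apply: (@le_trans _ _ (m.+1%:R%:E * nu (\bigcup_i G m i))%E).
      rewrite lee_pmul2l//; apply: le_measure; rewrite ?inE//.
      exact: bigcap_inf.
    (* With the [G m i] made disjoint, the bounds of [average_outside] add up to at most the
       variation. *)
    rewrite seqDU_bigcup_eq measure_bigcup//; last first.
      by move=> i _; exact: seqDU_measurable.
    rewrite -nneseriesZl//.
    apply: lime_le; first by apply: is_cvg_nneseries => *; exact: mule_ge0.
    apply: nearW => n.
    apply: le_trans (vector_variation_ge (F := fun i : 'I_n => seqDU (G m) i) _ _ _ _ _) => //.
    + rewrite big_mkord -sumEFin.
      under [leLHS]eq_bigl => i do rewrite in_setT.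
      apply: lee_sum => i _.
      have mi : measurable (seqDU (G m) i) by exact: seqDU_measurable.
      (* A point [w0] of the piece is what certifies that the ball misses [K m]. *)
      have [h|/existsNP[w0 nh]] := pselect (forall w, ~ seqDU (G m) i w).
        rewrite (_ : seqDU _ _ = set0) ?measure0 ?mule0 ?lee_fin//.
        by apply/seteqP; split=> // w /h.
      have [w0G _] : seqDU (G m) i w0 by exact: contrapT.
      rewrite -[X in (_ * X)%E]fineK ?fin_num_measure// -EFinM lee_fin.
      by apply: (average_outside mi _ w0G.1) => w [[]].
    + by move=> i; exact: seqDU_measurable.
    + move=> i j _ _ ij; apply: val_inj.
      exact: (@trivIset_seqDU _ (G m) i j).
  have [v Vv] : exists v : R, vector_variation J setT = v%:E.
    exists (fine (vector_variation J setT)); rewrite fineK// fin_numE -ltey Jfin andbT.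
    by rewrite gt_eqF// (lt_le_trans (ltNyr 0))// (le_trans _ (UV 0%N))// mule_ge0.
  have nuE : nu (\bigcap_m \bigcup_i G m i) \is a fin_num by exact: fin_num_measure.
  apply/eqP; rewrite eq_le measure_ge0 andbT leNgt; apply/negP => nuE0.
  have r0 : 0 < fine (nu (\bigcap_m \bigcup_i G m i)).
    by rewrite -lte_fin fineK.
  (* This index makes [(m + 1) * nu] exceed the finite variation [v]. *)
  have := UV (Num.truncn (v / fine (nu (\bigcap_m \bigcup_i G m i)))).
  rewrite Vv -[X in (_ * X)%E]fineK// -EFinM lee_fin -ler_pdivlMr// leNgt => /negP; apply.
  exact: truncnS_gt.
- apply: filterS cg => w cw m nUw; apply: contrapT => nK; apply: nUw.
  have /nbhs_ballP[e /= e0 eK] : nbhs (g w) (~` K m).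
    by apply: open_nbhs_nbhs; split=> //; exact/closed_openC.
  (* A ball of radius below [e / 2] containing [g w] lies within distance [e] of [g w], hence misses
     [K m]. *)
  have [i [ci ie]] := cw (e / 2) (divr_gt0 e0 (ltr0Sn _ _)).
  exists i => //; split=> // z cz; apply: eK; rewrite -ball_normE /ball_/=.
  have h1 : `|g w - (c i).1| < e / 2 by rewrite distrC (le_lt_trans ci).
  have h2 : `|(c i).1 - z| < e / 2 by exact: le_lt_trans cz ie.
  rewrite -(subrKA (c i).1) (le_lt_trans (ler_normD _ _))//.
  by rewrite [ltRHS](splitr e) ltrD.
Qed.

Lemma semi_embedding_factor : exists (f : T -> X) (B : nat -> set T),
  [/\ forall m, measurable (B m), \bigcup_m B m = setT,
      forall m w, B m w -> `|f w| <= m.+1%:R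
    & {ae nu, forall w, L (f w) = g w}].
Proof.
have [U [mU U0] [N [mN N0 NU]]] := density_ae_in_range.
pose N' := N `|` \bigcap_m U m.
have mN' : measurable N' by apply: measurableU => //; exact: bigcap_measurable.
have N'0 : nu N' = 0.
  by apply/measure_negligible => //; apply: negligibleU; apply/negligibleP => //;
    exact: bigcap_measurable.
have fK w m : ~ N' w -> ~ U m w -> K m (g w).
  by move=> nN' nU; apply: contrapT => h; apply: nN'; left; apply: NU => /(_ m nU).
pose f w := if w \in N' then 0 else xget 0 [set x | L x = g w].
(* The null set [N'] is put into every [B m]: [f] is 0 there, so the bound persists and the union is
   the whole space. *)
exists f, (fun m => ~` U m `|` N').
have Lf w m : ~ N' w -> ~ U m w -> L (f w) = g w /\ `|f w| <= m.+1%:R.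
  move=> nN' nU; have [x xm Lx] := imageK (fK _ _ nN' nU).
  rewrite /f memNset//; case: xgetP => [z _ Lz|/(_ x)/(_ Lx)//].
  (* Injectivity identifies the chosen preimage with the one of norm at most [m + 1]. *)
  by split=> //; rewrite (_ : z = x)//; apply: iL; rewrite Lx.
split.
- by move=> m; apply: measurableU => //; exact: measurableC.
- apply/seteqP; split=> // w _; have [N'w|nN'w] := pselect (N' w).
    by exists 0%N => //; right.
  have /existsNP[m nU] : ~ forall m, U m w by move=> h; apply: nN'w; right => m _.
  by exists m => //; left.
- move=> m w Bw; have [N'w|nN'w] := pselect (N' w).
    by rewrite /f mem_set// normr0.
  by case: Bw => // nU; have [] := Lf w m nN'w nU.
- exists N'; split=> // w /= h; apply: contrapT => nN'w; apply: h.
  have /existsNP[m nU] : ~ forall m, U m w by move=> h; apply: nN'w; right => m _.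
  by have [] := Lf w m nN'w nU.
Qed.

End SemiEmbedding.

Lemma dual_comp {R : realType} {X Y : normedModType R} (L : {linear X -> Y})
    (f : Y -> R^o) : continuous L -> dual Y f -> dual X (f \o L).
Proof.
move=> cL [lf cf]; split=> [a x y|x]; first by rewrite /= linearP lf.
by apply: continuous_comp; [exact: cL|exact: cf].
Qed.

Lemma countably_additive_dual {d} {T : measurableType d} {R : realType}
    {X : normedModType R} (I : set T -> X) (f : X -> R^o) :
  dual X f -> countably_additive I -> countably_additive (f \o I).
Proof.
move=> df Iadd; have [F fF] := dual_linear df; have [_ cf] := df.
by rewrite fF in cf *; exact: countably_additive_comp.
Qed.

(** * The subspace of represented functionals *)

Section BoundedVariation.
Context {d : measure_display} {T : measurableType d} {R : realType}.
Context {X : completeNormedModType R} (nu : probability T R).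
Variables (J : set T -> X) (f : T -> X) (B : nat -> set T).
Hypothesis fB : forall m w, B m w -> `|f w| <= m.+1%:R.

(** Only sets inside some [B m] are tested: there [phi \o f] is bounded, so the integrals make sense
    before global integrability is known. *)
Definition represented : set (X -> R^o) := [set phi | [/\ dual X phi,
  measurable_fun setT (phi \o f) &
  forall m A, measurable A -> A `<=` B m -> \int[nu]_(w in A) phi (f w) = phi (J A)]].

Lemma dual_locally_integrable phi m A : dual X phi -> measurable_fun setT (phi \o f) ->
  measurable A -> A `<=` B m -> nu.-integrable A (EFin \o (phi \o f)).
Proof.
move=> dphi mphi mA AB; have [M M0 phiM] := dual_bounded dphi.
apply: measurable_bounded_integrable => //.
- by rewrite (le_lt_trans (probability_le1 _ mA))// ltry.
- exact: measurable_funTS.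
- exists (M * m.+1%:R); split=> [|r Mr w /AB Bw]/=; first exact: num_real.
  apply: le_trans (ltW Mr); apply: (le_trans (phiM _)).
  by rewrite ler_wpM2l ?fB// ltW.
Qed.

Lemma represented_linear : linear_subspace represented.
Proof.
split=> [phi []//||a phi psi [dphi mphi phiJ] [dpsi mpsi psiJ]].
- split.
  + split=> [a x y|x]; last exact: cst_continuous.
    by rewrite -[LHS]/(0 : R) -[RHS]/(a * 0 + 0) mulr0 addr0.
  + exact: measurable_cst.
  + by move=> m A mA _; rewrite Rintegral_cst// mul0r.
- have [lphi cphi] := dphi; have [lpsi cpsi] := dpsi; split.
  + split=> [b x y|x].
      by rewrite !fctE lphi lpsi !scalerDr addrACA !scalerA mulrC.
    by apply: cvgD; [apply: cvgZr; exact: cphi|exact: cpsi].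
  + by apply: measurable_funD => //; exact: measurable_funM.
  + move=> m A mA AB.
    have iphi := dual_locally_integrable dphi mphi mA AB.
    have ipsi := dual_locally_integrable dpsi mpsi mA AB.
    rewrite -[RHS]/(a * phi (J A) + psi (J A)) -(phiJ m)// -(psiJ m)//.
    rewrite -RintegralZl// -RintegralD//.
    by have := integrableZl mA a iphi.
Qed.

Lemma represented_seq_closed : weak_star_seq_closed represented.
Proof.
move=> u phi ru dphi /ptws_seq_cvgP uphi.
have mu n : measurable_fun setT (u n \o f) by have [] := ru n.
have mphi : measurable_fun setT (phi \o f).
  by apply: (@measurable_fun_cvg _ _ _ _ (fun n => u n \o f)) => // w _; exact: uphi.
split=> // m A mA AB.
(* The radius [m + 1] covers [f] on [B m], so [M] dominates all the [u n \o f] on [A]. *)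
have [||M uM] := @Banach_Steinhauss R X R^o (range u) _ _ m.+1%:R.
- move=> _ [n _ <-]; have [du _ _] := ru n; split; last exact: du.1.
  have [M M0 uM] := dual_bounded du.
  move=> r; exists (M * r) => x xr; apply: (le_trans (uM x)).
  by rewrite ler_wpM2l// ltW.
- move=> x; have /cvg_seq_bounded[M [_ uM]] : cvgn (fun n => u n x : R^o).
    by apply/cvg_ex; exists (phi x); exact: uphi.
  exists (M + 1) => _ [n _ <-]; apply: (uM (M + 1)) => //.
  by rewrite ltrDl.
have iM : nu.-integrable A (fun=> M%:E) by exact: finite_measure_integrable_cst.
have [||||iphi _ cphi] := @dominated_convergence _ _ _ nu A mA
  (fun n w => (u n (f w))%:E) (fun w => (phi (f w))%:E) (fun=> M%:E) _ _ _ iM.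
- by move=> n; apply/measurable_EFinP; exact: measurable_funTS (mu n).
- by apply/measurable_EFinP; exact: measurable_funTS mphi.
- apply: aeW => w _; apply: cvg_EFin; first exact: nearW.
  exact: uphi.
- apply: aeW => w n Aw; rewrite lee_fin; apply: uM; first by exists n.
  exact: fB (AB _ Aw).
have := cphi; rewrite -[X in _ --> X](fineK (integrable_fin_num mA iphi)).
move=> /fine_cvgP[_ cphi'].
apply: (@cvg_unique _ (@Rhausdorff R) _ _ _ _ cphi').
have /= := uphi (J A); apply: cvg_trans; apply: near_eq_cvg; near=> n.
by rewrite /=; have [_ _ uJ] := ru n; rewrite -(uJ m).
Unshelve. all: by end_near. Qed.

End BoundedVariation.

(** * Densities for bounded and for sigma-finite variation *)

Section WeakRadonNikodym.
Context {d : measure_display} {T : measurableType d} {R : realType}.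
Context {X Y : completeNormedModType R} (nu : probability T R).
Variable L : {linear X -> Y}.
Hypothesis nu_complete : measure_is_complete nu.
Hypothesis L_semi : semi_embedding L.
Hypothesis X_D' : property_D' X.
Hypothesis Y_RNP : RNP nu Y.

Lemma bounded_variation_density (J : set T -> X) : countably_additive J ->
  (vector_variation J setT < +oo)%E -> abs_continuous nu J ->
  exists f : T -> X, forall phi, dual X phi -> nu.-integrable setT (EFin \o (phi \o f)) /\
    forall A, measurable A -> \int[nu]_(w in A) phi (f w) = phi (J A).
Proof.
move=> Jadd Jbv Jnu; have [cL iL clL] := L_semi.
have LJbv : (vector_variation (L \o J) setT < +oo)%E.
  have [M M0 LM] := continuous_linear_norm_bound cL.
  have [v Vv] : exists v : R, (vector_variation J setT <= v%:E)%E.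
    move: Jbv; case: (vector_variation J setT) => [v _|//|_]; first by exists v.
    by exists 0; rewrite leNye.
  apply: (@le_lt_trans _ _ (M * v)%:E); last exact: ltry.
  apply: ub_ereal_sup => _ [n [F [mF tF FT ->]]].
  rewrite lee_fin (@le_trans _ _ (M * \sum_(i < n) `|J (F i)|))//.
    by rewrite mulr_sumr; apply: ler_sum => i _; exact: LM.
  apply: ler_wpM2l; first exact: ltW.
  rewrite -lee_fin; apply: le_trans Vv.
  exact: vector_variation_ge.
have [g ig gJ] := Y_RNP (countably_additive_comp cL Jadd) LJbv
  (fun A mA A0 => etrans (congr1 L (Jnu A mA A0)) (linear0 L)).
have [f [B [mB BT fB Lfg]]] := semi_embedding_factor nu_complete iL clL Jbv ig.1 gJ.
exists f.
(* The scalar identities for [g] pass to [L \o f] by almost everywhere equality, with completeness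
   giving measurability. *)
have Lf_int psi A : dual Y psi -> measurable A ->
    measurable_fun setT (psi \o L \o f) /\
    \int[nu]_(w in A) psi (L (f w)) = psi (L (J A)).
  move=> dpsi mA; have iA := bochner_integrable_dual nu_complete ig dpsi.
  have eqfg : ae_eq nu setT (EFin \o (psi \o g)) (EFin \o (psi \o L \o f)).
    by apply: filterS Lfg => w /= -> _.
  have mpsi : measurable_fun setT (EFin \o (psi \o L \o f)).
    exact: ae_measurable_fun nu_complete _ _ _ eqfg (measurable_int nu iA).
  split; first exact/measurable_EFinP.
  rewrite (bochner_integral_dual nu_complete ig dpsi mA (gJ A mA)) /Rintegral.
  congr fine; apply: ae_eq_integral => //.
  - exact: measurable_funTS.
  - by apply: measurable_funTS; exact: measurable_int iA.
  - by apply: filterS Lfg => w /= -> _.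
have repD : dual X `<=` represented nu J f B.
  apply: property_D'_separating => //.
  - exact: represented_linear.
  (* The functionals [psi \o L] already separate points, by Hahn-Banach in [Y] and injectivity of
     [L]. *)
  - move=> x repx; apply: iL; rewrite linear0; apply/eqP; apply: contrapT => /negP Lx.
    have [psi dpsi] := dual_separates Lx; apply/negP; rewrite negbK; apply/eqP.
    apply: (repx (psi \o L)); split.
    + exact: dual_comp.
    + by have [] := Lf_int psi setT dpsi measurableT.
    + by move=> m A mA _; have [] := Lf_int psi A dpsi mA.
  - exact: represented_seq_closed.
move=> phi dphi; have [_ mphi phiJ] := repD _ dphi.
apply: (integral_countably_additive (C := B) (mu := phi \o J)) => //.
- exact: countably_additive_dual.
- by move=> k; exact: (dual_locally_integrable nu fB dphi mphi (mB k) (@subset_refl _ _)).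
Qed.

Lemma semi_embedding_WRNP : WRNP nu X.
Proof.
move=> I Iadd [F [mF FT Fv]] Inu.
have mD := seqDU_measurable mF; have tD := @trivIset_seqDU _ F.
have DT : \bigcup_k seqDU F k = setT by rewrite -seqDU_bigcup_eq.
have /choice[f fI] k : exists f : T -> X, forall phi, dual X phi ->
    nu.-integrable setT (EFin \o (phi \o f)) /\
    forall A, measurable A -> \int[nu]_(w in A) phi (f w) = phi (I (A `&` seqDU F k)).
  apply: (@bounded_variation_density (fun A => I (A `&` seqDU F k))).
  - exact: countably_additive_restrict.
  - apply: le_lt_trans (Fv k); apply: le_trans (vector_variation_restrict _ _) _ => //.
    by apply: le_vector_variation => //; exact: subDsetl.
  - move=> A mA A0; apply: Inu; first exact: measurableI.
    by apply/eqP; rewrite -measure_le0 -A0 le_measure ?inE//; exact: measurableI.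
(* The disjoint pieces cover the space, so the chosen index is that of the only piece containing
   [w]. *)
pose h w := f (xget 0%N [set k | seqDU F k w]) w.
have hD k w : seqDU F k w -> h w = f k w.
  move=> Dw; rewrite /h; case: xgetP => [j _ Dj|/(_ k)//].
  by rewrite (@tD j k)//; exists w.
have key phi : dual X phi -> nu.-integrable setT (EFin \o (phi \o h)) /\
    forall A, measurable A -> \int[nu]_(w in A) phi (h w) = phi (I A).
  move=> dphi.
  have ihD k : nu.-integrable (seqDU F k) (EFin \o (phi \o h)).
    apply: (@eq_integrable _ _ _ _ _ _ (EFin \o (phi \o f k))) => //.
      by move=> w /set_mem Dw; rewrite /= (hD k).
    by apply: integrableS (fI k _ dphi).1.
  apply: (integral_countably_additive (C := seqDU F) (mu := phi \o I)) => //.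
  - exact: countably_additive_dual.
  - rewrite -DT; apply/measurable_fun_bigcup => // k.
    by apply/measurable_EFinP; exact: measurable_int (ihD k).
  - move=> k A mA AD; have := (fI k _ dphi).2 A mA; rewrite setIidl//= => <-.
    by apply: eq_Rintegral => w /set_mem/AD Dw; rewrite (hD k).
exists h; last by move=> A mA phi dphi; rewrite (key _ dphi).2.
split=> [phi dphi|A mA]; first exact: (key _ dphi).1.
by exists (I A) => phi dphi; rewrite (key _ dphi).2.
Qed.

End WeakRadonNikodym.

Theorem theorem4p8 (R : realType) (d : measure_display)
  (Omega : measurableType d) (nu : probability Omega R)
  (X Y : completeNormedModType R) (T : {linear X -> Y}) :
  measure_is_complete nu -> semi_embedding T ->
  property_D' X -> RNP nu Y -> WRNP nu X.
Proof. exact: semi_embedding_WRNP. Qed.
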